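(* Consider the divide-and-conquer polynomial evaluation algorithm described in the context, run on a polynomial $A=(a_0,\dots,a_{n-1})$ with $n$ coefficients. Let $\zeta$ be the number of zero coefficients of $A$, and let $\langle n_1,\dots,n_\eta\rangle$ be the sizes of the $\eta$ equivalence classes of the relation $E$ (defined in the context) on the positions of the zero coefficients, so that $\sum_{i=1}^{\eta} n_i=\zeta$. Then the running time of the algorithm on $A$ is within $O\big((n-\zeta)\log n+\sum_{i=1}^{\eta} n_i\log\frac{n}{n_i}\big)\subseteq O(n\log n)$.
   Context: A polynomial $A(x)=\sum_{j=0}^{n-1}a_jx^j$ is given by its coefficient vector $(a_0,\dots,a_{n-1})$. The evaluation algorithm (the divide-and-conquer step of FFT-based polynomial multiplication) evaluates $A$ at all $(2n)$-th roots of unity as follows: it forms $A_{even}$ and $A_{odd}$, the polynomials whose coefficient vectors are the even-indexed and odd-indexed coefficients of $A$ respectively, so that $A(x)=A_{even}(x^2)+x\,A_{odd}(x^2)$; it recursively evaluates $A_{even}$ and $A_{odd}$ at the $n$-th roots of unity, and then combines these values in linear time to obtain $A$ at each $(2n)$-th root of unity. If at some recursive call all coefficients of the current polynomial are zero, the algorithm terminates that branch immediately. Equivalence relation $E$ on positions of zero coefficients of $A$: two positions $p,q$ with $a_p=a_q=0$ are equivalent iff (i) there exists $k\in\mathbb{Z}^+$ with $p\equiv q \pmod{2^k}$; (ii) all positions $r$ with $r\equiv p\pmod{2^k}$ hold zero coefficients; and (iii) there exists a position $t$ with $t\equiv p\pmod{2^{k-1}}$ whose coefficient is nonzero. (Intuitively,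 a class consists of the positions forming a vector of all-zero coefficients at one node of the recursion tree.) *)

(* Defs.v *)
From mathcomp Require Import all_boot all_order all_algebra.
From mathcomp Require Import all_classical all_reals all_analysis.
From mathcomp Require Import ring.

Set Implicit Arguments.
Unset Strict Implicit.
Unset Printing Implicit Defensive.
Import Order.TTheory GRing.Theory Num.Theory.
Local Open Scope ring_scope.

(* A value together with the number of elementary steps spent to obtain it.   *)
Definition timed (T : Type) : Type := (T * nat)%type.

Definition step (T : Type) (k : nat) (v : T) : timed T := (v, k).

Definition bind (T U : Type) (m : timed T) (f : T -> timed U) : timed U :=
  ((f m.1).1, (m.2 + (f m.1).2)%N).

Notation "'let!' x ':=' m 'in' f" := (bind m (fun x => f))
  (at level 200, x name, m at level 100, f at level 200).

Section Algorithm.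
Variable F : fieldType.
Implicit Types (A s : seq F) (w x : F).

(* A polynomial is given by its coefficient vector, a sequence in which zero  *)
(* entries, trailing ones included, are kept.  Every comparison, field        *)
(* operation and list cell written costs one step.                            *)

Fixpoint is_zero s : timed bool :=
  if s is a :: s' then
    if a == 0 then let! b := is_zero s' in step 1 b else step 1 false
  else step 1 true.

Fixpoint split_even_odd s : timed (seq F * seq F) :=
  if s is a :: s' then
    let! eo := split_even_odd s' in step 1 (a :: eo.2, eo.1)
  else step 1 ([::], [::]).

(* From e_j = A_even(w^(2j)), o_j = A_odd(w^(2j)) and x = w^i, the values     *)
(* e_j + w^(i+j) o_j and e_j - w^(i+j) o_j: those of A at w^j and w^(j+n),    *)
(* when i = 0 and w has order 2n.                                             *)
Fixpoint butterfly w x (es os : seq F) : timed (seq F * seq F) :=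
  if es is e :: es' then
    if os is o :: os' then
      let! t := step 1 (x * o) in
      let! x' := step 1 (x * w) in
      let! r := butterfly w x' es' os' in
      step 4 (e + t :: r.1, e - t :: r.2)
    else step 1 ([::], [::])
  else step 1 ([::], [::]).

(* Values, at the 2^(h+1) powers of w, of a polynomial with at most 2^h       *)
(* coefficients.  The first test is the one that cuts all-zero branches.      *)
Fixpoint eval_rec (h : nat) w s : timed (seq F) :=
  let! z := is_zero s in
  if z then step (2 ^ h.+1) (nseq (2 ^ h.+1) 0) else
  if h is h'.+1 then
    let! eo := split_even_odd s in
    let! w2 := step 1 (w * w) in
    let! es := eval_rec h' w2 eo.1 in
    let! os := eval_rec h' w2 eo.2 in
    let! r := butterfly w 1 es os in
    step (size r.1) (r.1 ++ r.2)
  else step 2 [:: head 0 s; head 0 s].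

(* The recursion from 2n-th to n-th roots of unity requires a power of two:   *)
(* this is the least h such that 2^h >= n, so 2^h = n if n is a power of two. *)
Definition depth (n : nat) : nat := up_log 2 n.

Definition evaluate w A : timed (seq F) := eval_rec (depth (size A)) w A.

Definition running_time w A : nat := (evaluate w A).2.

Definition zeros A : {set 'I_(size A)} := [set p : 'I_(size A) | A`_p == 0].

Definition zeta A : nat := #|zeros A|.

Definition E A (p q : 'I_(size A)) : Prop :=
  A`_p = 0 /\ A`_q = 0 /\
  exists k : nat, [/\ (0 < k)%N,
    p = q %[mod 2 ^ k],
    forall r : 'I_(size A), r = p %[mod 2 ^ k] -> A`_r = 0 &
    exists t : 'I_(size A), t = p %[mod 2 ^ k.-1] /\ A`_t <> 0].

Definition classes A : {set {set 'I_(size A)}} :=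
  equivalence_partition (fun p q : 'I_(size A) => `[< E p q >]) (zeros A).

(* E is reflexive on the zero positions only if A has a nonzero coefficient:  *)
(* when A = 0 there is no t, hence no class at all.                           *)
Definition nonzero A : bool := has (fun a => a != 0) A.

Lemma E_equivalence A : nonzero A ->
  {in zeros A & &, equivalence_rel (fun p q => `[< E p q >])}.
Proof.
move=> /(has_nthP 0)[t0 t0A At0].
have modw k l (a b : nat) : (k <= l)%N ->
    a = b %[mod 2 ^ l] -> a = b %[mod 2 ^ k].
  move=> kl ab; have d := dvdn_exp2l 2 kl.
  by rewrite -(modn_dvdm a d) ab modn_dvdm.
have least (p q : 'I_(size A)) k l : p = q %[mod 2 ^ k] -> (0 < l)%N ->
    (forall s : 'I_(size A), s = p %[mod 2 ^ k] -> A`_s = 0) ->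
    (exists u : 'I_(size A), u = q %[mod 2 ^ l.-1] /\ A`_u <> 0) -> (l <= k)%N.
  move=> pq l0 kz [u [uq Au]]; rewrite leqNgt; apply/negP => kl; apply: Au.
  by apply: kz; rewrite pq; apply: modw uq; rewrite -ltnS prednK.
have Esym (p q : 'I_(size A)) : E p q -> E q p.
  move=> [p0 [q0 [k [k0 pq kz [t [tp At]]]]]]; split=> //; split=> //.
  exists k; split=> // [s sq|]; first by apply: kz; rewrite sq.
  by exists t; split=> //; rewrite tp; apply: modw pq; exact: leq_pred.
have Etrans (p q r : 'I_(size A)) : E p q -> E q r -> E p r.
  move=> [p0 [_ [k [k0 pq kz kt]]]] [_ [r0 [l [l0 qr lz lt]]]].
  split=> //; split=> //; exists k; split=> //.
  have lk : (l <= k)%N by exact: (least p q).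
  have kl : (k <= l)%N by apply: (least q p) => //; apply: modw (esym pq).
  by rewrite pq; apply: modw qr.
move=> p q r; rewrite !inE => /eqP p0 /eqP q0 /eqP r0; split=> /=.
  split=> //; split=> //.
  pose P k := [forall s : 'I_(size A), (s == r %[mod 2 ^ k]) ==> (A`_s == 0)].
  have exP : exists k, P k.
    exists (size A); apply/forallP => s; apply/implyP.
    have lt_exp (v : 'I_(size A)) : (v < 2 ^ size A)%N.
      by apply: (ltn_trans (ltn_ord v)); exact: ltn_expl.
    by rewrite !modn_small// => /eqP/val_inj ->; rewrite r0.
  case: (ex_minnP exP) => k Pk mink.
  have k0 : (0 < k)%N.
    case: k Pk {mink} => // /forallP/(_ (Ordinal t0A)).
    by rewrite expn0 !modn1 /= (negPf At0).
  exists k; split=> //.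
    by move=> s /eqP sr; move/forallP: Pk => /(_ s); rewrite sr => /eqP.
  have : ~~ P k.-1 by apply/negP => /mink; rewrite leqNgt prednK// leqnn.
  rewrite negb_forall => /existsP[t]; rewrite negb_imply => /andP[/eqP tr At].
  by exists t; split=> //; exact/eqP.
move=> Epq; apply: asbool_equiv_eq; split.
  exact/Etrans/Esym.
exact: Etrans.
Qed.

Fact horner_even_odd s x :
  let eo := (split_even_odd s).1 in
  (Poly s).[x] = (Poly eo.1).[x * x] + x * (Poly eo.2).[x * x].
Proof.
elim: s => [|a s IH] /=; first by rewrite !horner0 mulr0 addr0.
by rewrite !horner_cons IH; ring.
Qed.

Fact size_split s n : (size s <= n.*2)%N ->
  let eo := (split_even_odd s).1 in (size eo.1 <= n)%N && (size eo.2 <= n)%N.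
Proof.
have [H1 H2] : size (split_even_odd s).1.1 = uphalf (size s) /\
         size (split_even_odd s).1.2 = (size s)./2.
  by elim: s => [//|a s [IH1 IH2]] /=; rewrite IH1 IH2.
move=> sn /=; rewrite H1 H2 leq_uphalf_double sn /=.
by rewrite -[leqRHS]doubleK half_leq.
Qed.

Fact is_zeroE s : (is_zero s).1 = all (pred1 0) s.
Proof. by elim: s => //= a s IH; case: ifP. Qed.

Fact butterflyE w x es os : size es = size os ->
  (butterfly w x es os).1 =
    (mkseq (fun j => es`_j + x * w ^+ j * os`_j) (size es),
     mkseq (fun j => es`_j - x * w ^+ j * os`_j) (size es)).
Proof.
elim: es x os => [|e es IH] x [|o os] //= [eqs].
rewrite IH //= /mkseq /= !mulr1; congr (_ :: _, _ :: _);
  rewrite -[1%N]/(1 + 0)%N iotaDl -map_comp; apply: eq_map => j /=;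
  by rewrite exprS mulrA.
Qed.

Lemma eval_recE h w s : (size s <= 2 ^ h)%N -> w ^+ (2 ^ h) = -1 ->
  (eval_rec h w s).1 = mkseq (fun j => (Poly s).[w ^+ j]) (2 ^ h.+1).
Proof.
have zero_case k (v : F) (t : seq F) : all (pred1 0) t ->
    nseq (2 ^ k) 0 = mkseq (fun j => (Poly t).[v ^+ j]) (2 ^ k).
  move=> /allP s0; have -> : Poly t = 0.
    apply/polyP => i; rewrite coef_Poly coef0.
    have [it|/(nth_default 0)//] := ltnP i (size t).
    by apply/eqP/s0; rewrite mem_nth.
  apply: (@eq_from_nth _ 0); rewrite size_nseq ?size_mkseq// => i ilt.
  by rewrite nth_nseq nth_mkseq // ilt horner0.
elim: h w s => [|h IH] w s sh wh; rewrite /eval_rec -/eval_rec /= is_zeroE;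
  case: ifP => z; [exact: (zero_case 1%N) | | exact: zero_case |].
  case: s sh z => [|a [|]] //= _ _.
  by rewrite /mkseq /= !horner_cons !horner0 !mul0r add0r.
have sw : (w * w) ^+ (2 ^ h) = -1 by rewrite -expr2 -exprM -expnS.
rewrite expnS mul2n in sh.
have /andP[s1 s2] := size_split sh.
rewrite /= !IH // butterflyE ?size_mkseq //=.
apply: (@eq_from_nth _ 0) => [|i].
  by rewrite size_cat !size_mkseq addnn -mul2n -expnS.
rewrite size_cat !size_mkseq nth_cat size_mkseq => ilt.
rewrite [RHS]nth_mkseq; last by rewrite expnS mul2n -addnn.
rewrite horner_even_odd; case: ltnP => ih.
  by rewrite !nth_mkseq // mul1r exprMn.
have ilt' : (i - 2 ^ h.+1 < 2 ^ h.+1)%N by rewrite ltn_subLR.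
have -> : w ^+ i = - w ^+ (i - 2 ^ h.+1).
  by rewrite -{1}(subnK ih) exprD wh mulrN1.
by rewrite !nth_mkseq // mul1r exprMn mulrNN mulNr.
Qed.

Lemma evaluateE w A :
  (2 * 2 ^ depth (size A)).-primitive_root w ->
  (evaluate w A).1 =
    mkseq (fun j => (Poly A).[w ^+ j]) (2 * 2 ^ depth (size A)).
Proof.
move=> wP; rewrite /evaluate eval_recE ?expnS//; first exact: up_logP.
have /eqP := prim_expr_order wP; rewrite mulnC exprM sqrf_eq1 => /orP[|/eqP//].
rewrite -(prim_order_dvd wP) gtnNdvd ?expn_gt0//.
by rewrite -[ltnLHS]mul1n ltn_pmul2r ?expn_gt0.
Qed.

End Algorithm.

Definition log2 (R : realType) (x : R) : R := ln x / ln 2.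

(* Asymptotics as the size of the input tends to infinity, over the inputs    *)
(* that belong to D.                                                          *)
Definition big_oh (R : realType) (I : Type) (D : set I) (sz : I -> nat)
    (g : I -> R) : set (I -> R) :=
  [set f | exists (C : R) (n0 : nat), forall x : I,
     D x -> (n0 <= sz x)%N -> `|f x| <= C * `|g x|]%classic.

(* Main.v *)
(* A node at depth k of the recursion tree is a residue class modulo 2^k of    *)
(* positions; call it live if it holds a nonzero coefficient.  A call costs a *)
(* constant times 2^(h-k), which is at most a constant times the size of the  *)
(* node when the node is live; the cost of a cut branch is charged to its     *)
(* live parent.  So the running time is at most a constant times the number   *)
(* of pairs (position, live node containing it).  A nonzero position lies in  *)
(* h + 1 = O(log n) live nodes.  A zero position of a class of size n_i that  *)
(* becomes dead at depth k lies in k live nodes, and n_i <= ceil(n / 2^k)     *)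
(* gives k = O(log (n / n_i)).                                                *)

Require Import Defs.
From mathcomp Require Import all_boot all_order all_algebra.
From mathcomp Require Import all_classical all_reals all_analysis.
From mathcomp Require Import zify lra.
Import Order.TTheory GRing.Theory Num.Theory.
Local Open Scope ring_scope.

(** Both the running time and the logarithmic bound are compared with [weight], the number of pairs
    (position, live node containing it). Counted by nodes, it dominates the time: [weightS] follows
    the recursion, and [eval_rec_cost] charges each live call to its own positions. Counted by
    positions, it is bounded in [weight_le]: a nonzero position contributes [h + 1], while the
    members of a class of [E] all die at the same depth [k] and are congruent modulo [2^k], which
    limits their number ([class_weight]). These counts stay in the naturals, as [2^k * x^3 <= n^3],
    until [natr_le_log2] takes logarithms. The inclusion in O(n log n) holds because
    [n / n_i <= n]. *)

Section Cost.
Variable F : fieldType.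
Implicit Types (s A : seq F).

(** * Live nodes of the recursion tree and their weight *)

Definition live s (k p : nat) : bool :=
  has (fun r => (r == p %[mod 2 ^ k]) && (s`_r != 0)) (iota 0 (size s)).

Lemma liveP s k p :
  reflect (exists2 r, r = p %[mod 2 ^ k] & s`_r != 0) (live s k p).
Proof.
apply: (iffP hasP) => [[r _ /andP[/eqP]]|[r rp sr]]; first by exists r.
exists r; last by rewrite rp eqxx.
by rewrite mem_iota /= ltnNge; apply: contra sr => /(nth_default 0) ->.
Qed.

Lemma live_anti s k l p : (k <= l)%N -> live s l p -> live s k p.
Proof.
move=> kl /liveP[r rp sr]; apply/liveP; exists r => //.
have d := dvdn_exp2l 2 kl.
by rewrite -(modn_dvdm r d) rp modn_dvdm.
Qed.

Lemma live0 s p : live s 0 p = ~~ all (pred1 0) s.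
Proof.
rewrite -has_predC; apply/liveP/(has_nthP 0) => [[r _ sr]|[r rs sr]].
  by exists r => //; rewrite ltnNge; apply: contra sr => /(nth_default 0) ->.
by exists r; rewrite ?expn0 ?modn1.
Qed.

Lemma nth_split_even_odd s i :
  (split_even_odd s).1.1`_i = s`_(i.*2) /\
  (split_even_odd s).1.2`_i = s`_(i.*2.+1).
Proof.
elim: s i => [|a s IH] i; first by rewrite !nth_nil.
split; first by case: i => [|i] //; rewrite doubleS /=; case: (IH i).
by case: (IH i).
Qed.

Lemma size_split_even_odd s :
  size (split_even_odd s).1.1 = uphalf (size s) /\
  size (split_even_odd s).1.2 = (size s)./2.
Proof. by elim: s => [//|a s [IH1 IH2]] /=; rewrite IH1 IH2. Qed.

Lemma modn_double r p k :
  (r.*2 == p.*2 %[mod 2 ^ k.+1]) = (r == p %[mod 2 ^ k]).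
Proof. by rewrite -!muln2 expnSr -!muln_modl eqn_pmul2r. Qed.

(** The recursion consumes the binary digits of a position from the lowest: the parity picks the
    half, the remaining digits the position in it. *)
Lemma live_bit s k p (b : bool) :
  live s k.+1 (p.*2 + b) =
  live (if b then (split_even_odd s).1.2 else (split_even_odd s).1.1) k p.
Proof.
have mod_bit r : (r.*2 + b == p.*2 + b %[mod 2 ^ k.+1]) = (r == p %[mod 2 ^ k]).
  by rewrite eqn_modDr modn_double.
have nth_bit r : (if b then (split_even_odd s).1.2 else (split_even_odd s).1.1)`_r
    = s`_(r.*2 + b).
  by case: (nth_split_even_odd s r) => H1 H2; case: b {mod_bit}; rewrite ?addn1 ?addn0.
apply/liveP/liveP => [[r rp sr]|[r rp sr]]; last first.
  by exists (r.*2 + b)%N; [apply/eqP; rewrite mod_bit; exact/eqP|rewrite -nth_bit].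
have rb : odd r = b.
  have : r = p.*2 + b %[mod 2].
    have d : (2 %| 2 ^ k.+1)%N by rewrite expnS dvdn_mulr.
    by rewrite -(modn_dvdm r d) rp modn_dvdm.
  by rewrite !modn2 oddD odd_double /=; case: (odd r) b {mod_bit nth_bit rp} => [] [].
have rE : r = (r./2.*2 + b)%N by rewrite -rb addnC odd_double_half.
exists r./2; last by rewrite nth_bit -rE.
by apply/eqP; rewrite -mod_bit -rE; exact/eqP.
Qed.

Definition weight h s : nat := \sum_(p < size s) \sum_(k < h.+1) live s k p.

Lemma sum_parity (f : nat -> nat) n :
  \sum_(p < n) f p =
  (\sum_(p < uphalf n) f p.*2 + \sum_(p < n./2) f p.*2.+1)%N.
Proof.
elim: n => [|n IH]; first by rewrite !big_ord0.
rewrite big_ord_recr /= IH uphalf_half.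
have nE : f n = f (odd n + n./2.*2)%N by rewrite odd_double_half.
by rewrite nE; case: (odd n); rewrite /= ?add0n ?add1n !big_ord_recr /=; lia.
Qed.

Lemma weightS h s : ~~ all (pred1 0) s ->
  weight h.+1 s = (size s + weight h (split_even_odd s).1.1
                          + weight h (split_even_odd s).1.2)%N.
Proof.
move=> s0; rewrite /weight.
under eq_bigr do rewrite big_ord_recl live0 s0.
rewrite big_split /= sum1_card card_ord -addnA; congr (_ + _)%N.
rewrite (sum_parity (fun p => \sum_(i < h.+1) live s (bump 0 i) p)%N).
have [-> ->] := size_split_even_odd s.
congr (_ + _)%N; apply: eq_bigr => p _; apply: eq_bigr => i _.
  by rewrite -(addn0 p.*2) (live_bit s i p false).
by rewrite -(addn1 p.*2) (live_bit s i p true).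
Qed.

(** * Cost of the recursion against the weight *)

Lemma is_zero_cost s : ((is_zero s).2 <= (size s).+1)%N.
Proof. by elim: s => //= a s IH; case: ifP => //= _; lia. Qed.

Lemma split_even_odd_cost s : (split_even_odd s).2 = (size s).+1.
Proof. by elim: s => //= a s ->; rewrite addn1. Qed.

Lemma butterfly_size w x (es os : seq F) :
  size (butterfly w x es os).1.1 = minn (size es) (size os) /\
  size (butterfly w x es os).1.2 = minn (size es) (size os).
Proof.
elim: es x os => [|e es IH] x [|o os] //=.
by case: (IH (x * w) os) => -> ->; rewrite minnSS.
Qed.

Lemma butterfly_cost w x (es os : seq F) :
  (butterfly w x es os).2 = (6 * minn (size es) (size os)).+1%N.
Proof.
elim: es x os => [|e es IH] x [|o os] //=; rewrite ?min0n ?minn0 //.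
by rewrite IH minnSS; lia.
Qed.

Lemma eval_rec_size h w s : (size (eval_rec h w s).1 <= 2 ^ h.+1)%N.
Proof.
elim: h w s => [|h IH] w s; rewrite /eval_rec -/(@eval_rec F) /=; case: ifP => _ //=;
  rewrite ?size_nseq // size_cat.
set es := (eval_rec h _ (split_even_odd s).1.1).1.
set os := (eval_rec h _ (split_even_odd s).1.2).1.
have [-> ->] := butterfly_size w 1 es os.
have := IH (w * w) (split_even_odd s).1.1; rewrite -/es [(2 ^ h.+2)%N]expnS.
by lia.
Qed.

(** A cut branch still scans its input and writes [2^(h+1)] zeros. *)
Lemma eval_rec_zero h w s : all (pred1 0) s -> (size s <= 2 ^ h)%N ->
  ((eval_rec h w s).2 <= 4 * 2 ^ h)%N.
Proof.
move=> s0 sh; have := is_zero_cost s; have := is_zeroE s; rewrite s0.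
have := expn_gt0 2 h.
by case: h sh => [|h] sh; rewrite /eval_rec -/(@eval_rec F) /= => h_gt0 -> /=;
  rewrite ?expnS in sh h_gt0 *; lia.
Qed.

(* The bound 2^h <= 2 size s + 1, unlike 2^h < 2 size s, is inherited by both *)
(* halves of s, and gives 2^h <= 3 size s on nonempty vectors.                *)
Lemma eval_rec_cost h w s : (size s <= 2 ^ h <= (size s).*2.+1)%N ->
  ((eval_rec h w s).2 <= 4 * 2 ^ h + 39 * weight h s)%N.
Proof.
elim: h w s => [|h IH] w s /andP[sh hs];
  have [s0|sN0] := boolP (all (pred1 0) s);
  try by apply: leq_trans (eval_rec_zero _ w _ s0 sh) _; lia.
  have := is_zero_cost s; have := is_zeroE s; rewrite (negPf sN0).
  by rewrite /eval_rec /= => -> /=; rewrite expn0 in sh hs *; lia.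
(* With [m = size s], the work outside the recursive calls is at most [2m + 4 + 7 * 2^(h+1)], hence
   at most [39m] since [2^(h+1) <= 2m + 1]. The terms [4 * 2^h] of the two children add up to that
   of the parent. *)
rewrite weightS // /eval_rec -/(@eval_rec F) /=.
have := is_zero_cost s; have := is_zeroE s; rewrite (negPf sN0) => -> /= zs.
rewrite split_even_odd_cost butterfly_cost.
have [-> _] := butterfly_size w 1 (eval_rec h (w * w) (split_even_odd s).1.1).1
  (eval_rec h (w * w) (split_even_odd s).1.2).1.
have := eval_rec_size h (w * w) (split_even_odd s).1.1.
have [es os] := size_split_even_odd s.
have := IH (w * w) (split_even_odd s).1.1.
have := IH (w * w) (split_even_odd s).1.2.
have s_gt0 : (0 < size s)%N by case: (s) sN0.
rewrite es os !expnS in sh hs *. lia.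
Qed.

(** * Depth at which zero positions die, and class sizes *)

Lemma live_mod s k p q : p = q %[mod 2 ^ k] -> live s k p = live s k q.
Proof. by move=> pq; apply: eq_has => r; rewrite pq. Qed.

(** At depth [h] each node holds at most one position. *)
Lemma dead_zero s h p : (size s <= 2 ^ h)%N -> (p < size s)%N -> s`_p = 0 ->
  ~~ live s h p.
Proof.
move=> sh ps sp0; apply/liveP => -[r rp /negP]; apply; apply/eqP.
have [rs|/(nth_default 0)//] := ltnP r (size s).
by rewrite !modn_small ?(leq_trans _ sh) // in rp; rewrite rp.
Qed.

Lemma sum_live_le s h k p : ~~ live s k p -> (\sum_(i < h) live s i p <= k)%N.
Proof.
move=> skp; suff : (\sum_(i < h) live s i p <= minn h k)%N by lia.
elim: h => [|h IH]; first by rewrite big_ord0.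
rewrite big_ord_recr /=; have [hk|kh] := ltnP h k.
  by apply: leq_trans (leq_add IH (leq_b1 _)) _; lia.
rewrite (negPf (contra (@live_anti s k h p kh) skp)) addn0.
by apply: leq_trans IH _; lia.
Qed.

(** The [k] in [E] is the depth at which [p] passes from live to dead. *)
Lemma E_live A (p q : 'I_(size A)) : E p q ->
  exists2 k, [/\ (0 < k)%N, p = q %[mod 2 ^ k] & A`_p = 0] &
             live A k.-1 p && ~~ live A k p.
Proof.
move=> [p0 [_ [k [k0 pq kz [t [tp /eqP At]]]]]]; exists k => //.
apply/andP; split; first by apply/liveP; exists t.
apply/liveP => -[r rp /eqP]; apply.
have [rs|/(nth_default 0)//] := ltnP r (size A).
by rewrite (kz (Ordinal rs)).
Qed.

(* From x <= ceil(n / K) one only gets log2 K <= log2 (n / x) + 1; since     *)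
(* n / x >= 4 / 3, the extra 1 is absorbed by a constant factor.              *)
Lemma expn_cube_le n K x :
  (1 < n)%N -> (1 < K < n.*2)%N -> (0 < x)%N -> (x.-1 * K < n)%N ->
  (K * x ^ 3 <= n ^ 3)%N.
Proof.
move=> n1 /andP[K1 Kn]; case: x => [//|[|m]] _ /=.
  by move=> _; rewrite exp1n muln1 !expnS expn0; nia.
set M := m.+1 => MK.
rewrite (@leq_trans ((M * K).+1 ^ 3)) ?leq_exp2r //.
(* With [K = L + 2] and [M = m + 1], the inequality [K (M+1)^3 <= (M K + 1)^3] holds coefficient by
   coefficient in [L] and [m]. *)
have {MK} -> : K = (K - 2).+2 by lia.
have -> : M = m.+1 by []; move: (K - 2)%N => L.
rewrite !expnS expn0; nia.
Qed.

Lemma class_weight A X p : nonzero A -> (1 < size A)%N -> X \in classes A ->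
  p \in X ->
  (2 ^ (\sum_(k < (depth (size A)).+1) live A k p) * #|X| ^ 3 <= size A ^ 3)%N.
Proof.
move=> nzA n1 /imsetP[x xz ->]; set Y := [set _ in _ | _] => pY.
have Exx : E x x by apply/asboolP; have [] := E_equivalence nzA xz xz xz.
have [k [k0 _ x0] /andP[kx kNx]] := E_live _ _ _ Exx.
have Yk q : q \in Y -> q = x %[mod 2 ^ k].
  rewrite inE => /andP[_ /asboolP/E_live[l [l0 xq _] /andP[lx lNx]]].
  (* By [live_anti], [x] passes from live to dead at only one depth. *)
  suff -> : k = l by [].
  apply/eqP; rewrite eqn_leq -(prednK k0) -(prednK l0) ltnNge [X in _ && X]ltnNge.
  apply/andP; split.
    by apply: contra lNx => lk; apply: live_anti kx; rewrite -(prednK l0).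
  by apply: contra kNx => kl; apply: live_anti lx; rewrite -(prednK k0).
have kh : (2 ^ k < (size A).*2)%N.
  have /andP[hn nh] := up_log_bounds (isT : 1 < 2)%N n1.
  have kh : (k <= depth (size A))%N.
    rewrite -(prednK k0) ltnNge; apply: contra (dead_zero _ _ _ nh (ltn_ord x) x0).
    by move=> hk; apply: live_anti kx.
  apply: (@leq_ltn_trans (2 ^ depth (size A))%N); first by rewrite leq_exp2l.
  by rewrite -[depth _]prednK ?(leq_trans k0) // expnS mul2n ltn_double.
apply: (@leq_trans (2 ^ k * #|Y| ^ 3)%N).
  rewrite leq_mul2r leq_exp2l // sum_live_le ?orbT //.
  by rewrite (live_mod _ _ _ _ (Yk p pY)).
have Y0 : (0 < #|Y|)%N by rewrite card_gt0; apply/set0Pn; exists p.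
apply: expn_cube_le => //; first by rewrite kh andbT -{1}(expn0 2) ltn_exp2l.
(* Members of [Y] share their remainder modulo [2^k], so their quotients tell them apart; this gives
   [#|Y| <= ceil(n / 2^k)]. *)
pose f (q : 'I_(size A)) : 'I_((size A).-1 %/ 2 ^ k).+1 := inord (q %/ 2 ^ k).
have fE (q : 'I_(size A)) : f q = (q %/ 2 ^ k)%N :> nat.
  by rewrite inordK // ltnS leq_div2r //; have := ltn_ord q; lia.
have f_inj : {in Y &, injective f}.
  move=> q r qY rY /(congr1 val) /=; rewrite !fE => qr; apply/val_inj => /=.
  by rewrite (divn_eq q (2 ^ k)) (divn_eq r (2 ^ k)) qr (Yk q) // (Yk r).
have : (#|Y| <= ((size A).-1 %/ 2 ^ k).+1)%N.
  by rewrite -(card_in_imset f_inj) (leq_trans (max_card _)) // card_ord.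
have := leq_trunc_div (size A).-1 (2 ^ k).
by move: ((size A).-1 %/ 2 ^ k)%N => d; nia.
Qed.

End Cost.

(** * Logarithms and asymptotics *)

Lemma natr_le_log2 (R : realType) (k x n : nat) :
  (0 < x)%N -> (0 < n)%N -> (2 ^ k * x ^ 3 <= n ^ 3)%N ->
  k%:R <= 3 * log2 (n%:R / x%:R : R).
Proof.
move=> x0 n0; have ln2 : 0 < ln 2 :> R by rewrite ln_gt0 // ltr1n.
have pos m : (0 < m)%N -> m%:R \is @Num.pos R by move=> m0; rewrite posrE ltr0n.
rewrite -(ler_nat R) natrM !natrX -ler_ln ?posrE ?mulr_gt0 ?exprn_gt0 ?ltr0n //.
rewrite lnM ?posrE ?exprn_gt0 ?ltr0n // !lnXn ?ltr0n // => le_ln.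
rewrite /log2 ln_div ?pos // mulrA ler_pdivlMr // -mulr_natl in le_ln *.
rewrite -![ln _ *+ 3]mulr_natl in le_ln; lra.
Qed.

Lemma classes_partition (F : fieldType) (A : seq F) :
  nonzero A -> finset.partition (classes A) (zeros A).
Proof. by move=> nzA; apply: equivalence_partitionP; exact: E_equivalence. Qed.

Lemma size_sub_zeta (F : fieldType) (A : seq F) :
  (size A - zeta A)%N = #|~: zeros A|.
Proof. by rewrite cardsCs finset.setCK card_ord. Qed.

Lemma running_time_le (F : fieldType) (w : F) (A : seq F) :
  nonzero A -> (1 < size A)%N ->
  (running_time w A <= 47 * weight F (depth (size A)) A)%N.
Proof.
move=> nzA n1; have /andP[hn nh] := up_log_bounds (isT : 1 < 2)%N n1.
have h2 : (2 ^ depth (size A) < (size A).*2)%N.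
  have h_gt0 : (0 < depth (size A))%N by rewrite up_log_gt0.
  by rewrite -(prednK h_gt0) expnS mul2n ltn_double.
have size_weight : (size A <= weight F (depth (size A)) A)%N.
  rewrite -[leqLHS]card_ord -sum1_card; apply: leq_sum => p _.
  by rewrite big_ord_recl live0 -has_predC (nzA : has (predC (pred1 0)) A).
have cost : (running_time w A <=
    4 * 2 ^ depth (size A) + 39 * weight F (depth (size A)) A)%N.
  by apply: eval_rec_cost; rewrite nh ltnW // ltnS ltnW.
(* 47 = 39 + 8: [4 * 2^h] is below [8 * size A], and the live root alone gives weight at least
   [size A]. *)
lia.
Qed.

Lemma weight_le (R : realType) (F : fieldType) (A : seq F) :
  nonzero A -> (1 < size A)%N ->
  (weight F (depth (size A)) A)%:R <=
  3 * ((size A - zeta A)%N%:R * log2 (size A)%:R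
    + \sum_(X in classes A) #|X|%:R * log2 ((size A)%:R / #|X|%:R)) :> R.
Proof.
move=> nzA n1; have n0 : (0 < size A)%N by exact: ltnW.
set h := depth (size A).
rewrite /weight (bigID (mem (zeros A))) /= natrD addrC mulrDr lerD //.
  have h_le : h.+1%:R <= 3 * log2 (size A)%:R :> R.
    (* A nonzero position is treated like a class of size one. *)
    rewrite -[(size A)%:R]divr1; apply: (@natr_le_log2 R _ 1%N) => //.
    have /andP[hn _] := up_log_bounds (isT : 1 < 2)%N n1.
    have h_gt0 : (0 < h)%N by rewrite up_log_gt0.
    rewrite -/(depth _) -/h in hn; rewrite exp1n muln1 -(prednK h_gt0).
    by rewrite !expnS expn0; nia.
  rewrite mulrCA size_sub_zeta (@le_trans _ _ (#|~: zeros A| * h.+1)%N%:R) //.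
    rewrite ler_nat -sum_nat_const.
    rewrite [leqRHS](eq_bigl (fun p => p \notin zeros A)) => [|p]; last by rewrite !inE.
    apply: leq_sum => p _; rewrite -[leqRHS]card_ord -sum1_card.
    by apply: leq_sum => k _; exact: leq_b1.
  by rewrite natrM ler_wpM2l.
rewrite (set_partition_big _ (classes_partition _ _ nzA)) /= natr_sum mulr_sumr.
apply: ler_sum => X XA; rewrite mulrCA natr_sum [leRHS]mulr_natl -[leRHS]sumr_const.
apply: ler_sum => p pX; apply: natr_le_log2 => //; last exact: class_weight.
by rewrite card_gt0; apply/set0Pn; exists p.
Qed.

Lemma log2_ge0 (R : realType) (x : R) : 1 <= x -> 0 <= log2 x.
Proof. by move=> x1; rewrite divr_ge0 ?ln_ge0 // ler1n. Qed.

Lemma class_term_bounds (R : realType) (x n : nat) : (x <= n)%N ->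
  0 <= x%:R * log2 (n%:R / x%:R : R) <= x%:R * log2 (n%:R : R).
Proof.
case: x => [|x] xn; first by rewrite !mul0r lexx.
have n0 : (0 < n)%N by exact: leq_trans xn.
rewrite mulr_ge0 ?log2_ge0 ?ler_pdivlMr ?mul1r ?ler_nat ?ltr0n //=.
rewrite ler_wpM2l // ler_wpM2r ?invr_ge0 ?ln_ge0 ?ler1n //.
rewrite ler_ln ?posrE ?divr_gt0 ?ltr0n // ler_pdivrMr ?ltr0n //.
by rewrite ler_peMr // ler1n.
Qed.

Theorem theorem2 (R : realType) (F : fieldType) :
  let inputs : set (F * seq F) := [set wA : F * seq F |
    (2 * 2 ^ depth (size wA.2)).-primitive_root wA.1 /\ nonzero wA.2]%classic in
  let O : (F * seq F -> R) -> set (F * seq F -> R) :=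
    big_oh inputs (fun wA : F * seq F => size wA.2) in
  let T : F * seq F -> R := fun wA => (running_time wA.1 wA.2)%:R in
  let bound : F * seq F -> R := fun wA =>
    (size wA.2 - zeta wA.2)%N%:R * log2 (size wA.2)%:R
    + \sum_(X in classes wA.2) #|X|%:R * log2 ((size wA.2)%:R / #|X|%:R) in
  let nlogn : F * seq F -> R := fun wA =>
    (size wA.2)%:R * log2 (size wA.2)%:R in
  (forall A : seq F, nonzero A -> (\sum_(X in classes A) #|X|)%N = zeta A)
  /\ O bound T
  /\ (O bound `<=` O nlogn)%classic.
Proof.
have part (A : seq F) : nonzero A ->
    (\sum_(X in classes A) #|X|)%N = zeta A.
  by move=> nzA; rewrite -(card_partition (classes_partition _ _ nzA)).
move=> inputs O T bound nlogn; split=> //.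
have bound_itv wA : inputs wA -> 0 <= bound wA <= nlogn wA.
  case: wA => w A [/= _ nzA].
  have A0 : (0 < size A)%N by case: (A) nzA.
  have X_itv (X : {set 'I_(size A)}) :=
    @class_term_bounds R _ _ (leq_trans (max_card (mem X)) (eq_leq (card_ord _))).
  rewrite /bound /nlogn /= addr_ge0 /=; last 2 first.
    - by rewrite mulr_ge0 // log2_ge0 // ler1n.
    - by apply: sumr_ge0 => X _; case/andP: (X_itv X).
  rewrite -[X in _ <= X%:R * _](@subnK (zeta A)); last first.
    by rewrite -[leqRHS]card_ord max_card.
  rewrite natrD mulrDl lerD2l -part // natr_sum mulr_suml.
  by apply: ler_sum => X _; case/andP: (X_itv X).
split.
  (* 141 = 47 * 3, from [running_time_le] and [weight_le]; both need size at least 2. *)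
  exists 141, 2 => -[w A] DwA n1; have [_ nzA] := DwA.
  have /andP[b0 _] := bound_itv _ DwA.
  rewrite (ger0_norm b0) ger0_norm ?ler0n //.
  apply: (le_trans (_ : _ <= (47 * weight F (depth (size A)) A)%N%:R)).
    by rewrite ler_nat running_time_le.
  have := weight_le R F A nzA n1; rewrite natrM /bound /=; lra.
(* [big_oh] allows a negative [C], hence the absolute value. *)
move=> f [C [n0 fC]]; exists `|C|, n0 => wA DwA nwA.
have /andP[b0 b_le] := bound_itv _ DwA.
apply: le_trans (fC _ DwA nwA) _.
apply: (@le_trans _ _ (`|C| * `|bound wA|)); first by rewrite ler_wpM2r ?ler_norm.
by rewrite ler_wpM2l // !ger0_norm // (le_trans b0).
Qed.
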